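(* For all integers $p\geq 8$ and $k\geq p-3$, we have $g^k_{p-3}(p)=k+3$.
   Context: A Gallai-$k$-coloring of the complete graph $K_n$ is a map $c:E(K_n)\to\{1,\dots,k\}$ (not necessarily surjective) with no rainbow triangle, i.e. every triangle receives at most two distinct colors. For integers $k\ge 1$ and $1\le q\le \binom{p}{2}$, $g^k_q(p)$ denotes the smallest positive integer $n$ such that every Gallai-$k$-coloring of $K_n$ contains a copy of $K_p$ whose edges receive at most $q$ distinct colors. *)

(* Defs.v *)
From mathcomp Require Import all_boot.

Set Implicit Arguments.
Unset Strict Implicit.
Unset Printing Implicit Defensive.

(* The edge set of the complete graph on the vertex set {0, ..., n-1}. *)
Definition edge (n : nat) := {e : {set 'I_n} | #|e| == 2}.

Section Coloring.

Variables n k : nat.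

(* Colors are numbered 0, ..., k-1 instead of 1, ..., k. *)
Definition coloring := {ffun edge n -> 'I_k}.

(* The colors received by the edges of the complete subgraph induced by A. *)
Definition colors_on (c : coloring) (A : {set 'I_n}) : {set 'I_k} :=
  [set c e | e : edge n & val e \subset A].

Definition gallai (c : coloring) : Prop :=
  forall T : {set 'I_n}, #|T| = 3 -> #|colors_on c T| <= 2.

End Coloring.

Definition forces (k q p n : nat) : Prop :=
  forall c : coloring n k, gallai c ->
    exists A : {set 'I_n}, #|A| = p /\ #|colors_on c A| <= q.

(* [gallai_number k q p m] means g^k_q(p) = m.  It is a relation, so it also
   asserts that the minimum exists. *)
Definition gallai_number (k q p m : nat) : Prop :=
  [/\ 0 < m, forces k q p m
    & forall n : nat, 0 < n -> forces k q p n -> m <= n].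

(* Main.v *)
Require Import Defs.
From mathcomp Require Import all_boot.
From mathcomp Require Import zify.

(** Lower bound.  On at most k + 2 vertices, color an edge with larger end i by
    i - 2, truncated at 0.  A set A with least vertex m receives exactly the
    colors x - 2 for x in A other than m, and only the vertices 1 and 2 give
    the same color, so A receives at least #|A| - 2 colors; a triangle receives
    at most two.

    Upper bound.  A set with at least three more vertices than colors is shrunk
    to p vertices one vertex at a time.  The excess of vertices over colors must
    not fall below three, so when it is exactly three a vertex is needed whose
    deletion destroys a color: one meeting all edges of that color
    ([losing_vertex]).

    Such a vertex exists on 9 or more vertices by a counting inequality.  Charge
    a color with the number of vertices needed to cover its edges, truncated at
    2, and let the load be the total charge: the number of colors plus the
    number of colors not destroyed by any deletion.  The load is subadditive
    under union of edge sets ([loadU]), and in a Gallai coloring of n >= 2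
    vertices it satisfies 2 load + 4 <= 3n ([load_pairs]).  If n - 3 colors were
    used and none could be destroyed, the load would be 2(n - 3), whence n <= 8.

    The inequality follows by induction from Gallai's decomposition
    ([gallai_decomposable]): either two parts joined in one color, or at least
    four parts with at most two colors between different parts.  With t parts,
    each of load at most (3 n_i - 3) / 2, and crossing edges of load at most 4,
    one gets 2 load + 4 <= 3n - 3t + 12, enough when t >= 4; the case t = 2 is
    checked by the sizes of the parts.

    The decomposition comes from the fact that, once three colors are used, some
    used color is disconnected ([disconnected_color]).  Each outside vertex
    sees a component of it in a single color ([component_module]), so the
    components can be contracted and the decomposition of the quotient lifted. *)

Set Implicit Arguments.
Unset Strict Implicit.
Unset Printing Implicit Defensive.

Lemma cards3_triple (T : finType) (A : {set T}) : #|A| = 3 ->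
  exists x y z, [/\ x != y, y != z, x != z & A = [set x; y; z]].
Proof.
move=> A3; have /card_gt0P[z zA] : 0 < #|A| by rewrite A3.
have /cards2P[x [y [xy Az]]] : #|A :\ z| == 2.
  by apply/eqP; have := cardsD1 z A; rewrite zA A3; lia.
have : (x \in A :\ z) && (y \in A :\ z) by rewrite Az !inE !eqxx orbT.
rewrite !inE => /andP[/andP[xz _] /andP[yz _]].
by exists x, y, z; split=> //; rewrite -Az setUC setD1K.
Qed.

(** * Charging colors by truncated covering numbers *)

Section GallaiColoring.

(* An edge coloring is a symmetric function of two vertices; [pairs] discards
   the diagonal. *)
Variables (T K : finType) (col : T -> T -> K).
Implicit Types (E F : {set T * T}) (A B X : {set T}) (a c g : K).

Definition pairs A : {set T * T} :=
  [set u | [&& u.1 \in A, u.2 \in A & u.1 != u.2]].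

Definition palette E : {set K} := [set col u.1 u.2 | u in E].

Definition avoid v E := [set u in E | (u.1 != v) && (u.2 != v)].

Definition robust E : {set K} :=
  [set a in palette E | [forall v, a \in palette (avoid v E)]].

(** The sum over all colors of the vertex cover number truncated at 2: the
    palette accounts for cover number at least 1, [robust] for at least 2. *)
Definition load E := #|palette E| + #|robust E|.

Lemma palette_pairsP A a :
  reflect (exists x y, [/\ x \in A, y \in A, x != y & col x y = a])
          (a \in palette (pairs A)).
Proof.
apply: (iffP imsetP) => [[[x y]]|[x [y [xA yA xy <-]]]].
  by rewrite inE /= => /and3P[xA yA xy] ->; exists x, y.
by exists (x, y); rewrite ?inE /= ?xA ?yA.
Qed.

Lemma paletteS E F : E \subset F -> palette E \subset palette F.
Proof. exact: imsetS. Qed.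

Lemma load_le E : load E <= 2 * #|palette E|.
Proof.
have : #|robust E| <= #|palette E|.
  by apply: subset_leq_card; apply/subsetP => a; rewrite inE => /andP[].
rewrite /load; lia.
Qed.

Lemma load0 : load set0 = 0.
Proof. by apply/eqP; rewrite -leqn0 (leq_trans (load_le _)) // /palette imset0 cards0. Qed.

Lemma load_star v E : avoid v E = set0 -> load E = #|palette E|.
Proof.
move=> E0; rewrite /load (_ : robust E = set0) ?cards0 ?addn0 //.
apply/setP => a; rewrite !inE; apply/negP => /andP[_ /forallP/(_ v)].
by rewrite E0 /palette imset0 inE.
Qed.

(** For one color the truncated cover number is subadditive; in terms of
    cardinalities, a color robust in the union but in neither part is present
    in both, where it was counted twice. *)
Lemma loadU E F : load (E :|: F) <= load E + load F.
Proof.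
have sub : robust (E :|: F) \subset
    robust E :|: robust F :|: (palette E :&: palette F).
  apply/subsetP => a; rewrite !inE /palette imsetU inE -!/(palette _).
  case/andP=> /orP aEF /forallP aR.
  (* an edge of the union avoiding v lies in one of the two parts *)
  have split v : (a \in palette (avoid v E)) || (a \in palette (avoid v F)).
    have := aR v; rewrite /avoid setIdE setIUl.
    by rewrite /palette imsetU inE -!setIdE.
  have sE v : (a \in palette (avoid v E)) -> a \in palette E.
    by apply/subsetP/paletteS/subsetP => u; rewrite inE => /andP[].
  have sF v : (a \in palette (avoid v F)) -> a \in palette F.
    by apply/subsetP/paletteS/subsetP => u; rewrite inE => /andP[].
  case aE: (a \in palette E); case aF: (a \in palette F) => //=.
  - by rewrite orbT.
  - rewrite !orbF; apply/forallP => v.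
    by case/orP: (split v) => // /sF; rewrite aF.
  - rewrite orbF; apply/forallP => v.
    by case/orP: (split v) => // /sE; rewrite aE.
  - by case: aEF; rewrite ?aE ?aF.
have := subset_leq_card sub.
have := cardsUI (palette E) (palette F).
have := leq_of_leqif (leq_card_setU (robust E :|: robust F) (palette E :&: palette F)).
have := leq_of_leqif (leq_card_setU (robust E) (robust F)).
have -> : palette E :|: palette F = palette (E :|: F) by rewrite /palette imsetU.
by rewrite /load; lia.
Qed.

Lemma load_bigcup (I : finType) (P : {pred I}) (E : I -> {set T * T}) :
  load (\bigcup_(i | P i) E i) <= \sum_(i | P i) load (E i).
Proof.
apply: (big_rec2 (fun F s => load F <= s)); first by rewrite load0.
by move=> i s F _ le; apply: leq_trans (loadU _ _) _; rewrite leq_add2l.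
Qed.

(** * Disconnected colors and Gallai's decomposition *)

Hypothesis colC : forall x y, col x y = col y x.

Hypothesis col_gallai : forall x y z, x != y -> y != z -> x != z ->
  [|| col x y == col y z, col x y == col x z | col y z == col x z].

Lemma gallai_eq g x y z : x != y -> y != z -> x != z ->
  col x y = g -> col x z != g -> col y z != g -> col x z = col y z.
Proof.
move=> xy yz xz <- nx ny; have := col_gallai xy yz xz.
by rewrite ![col x y == _]eq_sym (negPf nx) (negPf ny) /= => /eqP.
Qed.

Definition link A g : rel T :=
  [rel x y | [&& x \in A, y \in A, x != y & col x y == g]].

Lemma link_sym A g : connect_sym (link A g).
Proof.
apply: sym_connect_sym => x y; rewrite /link /= colC eq_sym.
by case: (x \in A); case: (y \in A).
Qed.

Lemma connect_in A g x y : connect (link A g) x y -> x \in A -> y \in A.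
Proof.
move=> xy xA; rewrite -(closed_connect _ xy) //.
by apply: (intro_closed (@link_sym A g)) => u w /and4P[].
Qed.

Lemma connect_link A g x y :
  connect (link A g) x y -> x != y -> exists z, link A g x z.
Proof.
case/connectP=> [[|z s]] /=; first by move=> _ ->; rewrite eqxx.
by case/andP=> xz _ _ _; exists z.
Qed.

Lemma unlinked_neq A g x y : ~~ connect (link A g) x y -> x != y.
Proof. by apply: contraNneq => ->. Qed.

Lemma unlinked_col A g x y : x \in A -> y \in A ->
  ~~ connect (link A g) x y -> col x y != g.
Proof.
move=> xA yA nxy; apply: contraNneq (nxy) => xy; apply: connect1.
by rewrite /link /= xA yA (unlinked_neq nxy) xy eqxx.
Qed.

(** Walking along an edge of color [g] inside the component, the triangle with an
    outside vertex has two sides of color other than [g], which must agree. *)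
Lemma component_module A g x x' y : x \in A -> y \in A ->
  connect (link A g) x x' -> ~~ connect (link A g) x y -> col x y = col x' y.
Proof.
move=> xA yA xx' nxy.
pose S := [pred z | connect (link A g) x z && (col x y == col z y)].
suff cl : closed (link A g) S.
  by have := closed_connect cl xx'; rewrite !inE connect0 eqxx xx' => /esym/eqP.
apply: (intro_closed (@link_sym A g)) => z z' zz'.
rewrite !inE => /andP[xz /eqP ->].
have xz' := connect_trans xz (connect1 zz').
have nzy : ~~ connect (link A g) z y.
  by apply: contra nxy; apply: connect_trans.
have nz'y : ~~ connect (link A g) z' y.
  by apply: contra nxy; apply: connect_trans.
case/and4P: zz' => zA z'A zz' /eqP zz'g.
rewrite xz'; apply/eqP; apply: (gallai_eq zz' _ _ zz'g).
- exact: unlinked_neq nz'y.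
- exact: unlinked_neq nzy.
- exact: unlinked_col nzy.
- exact: unlinked_col nz'y.
Qed.

(** Induction on the size of [A], deleting a vertex v.  If all colors were
    connected on [A], every color would be seen from v.  But if a color g
    disconnects the rest, v reaches each of its components in color g, and any
    other color at v is forced on all edges between its component and the other
    ones, so v sees at most one color besides g.  If the rest uses at most two
    colors, some color lives only at v and v sees nothing else. *)
Lemma disconnected_color A : 2 < #|palette (pairs A)| ->
  exists g x y, [/\ g \in palette (pairs A), x \in A, y \in A
                  & ~~ connect (link A g) x y].
Proof.
have [n] := ubnP #|A|; elim: n A => // n IHn A ltAn col3.
pose bad (t : K * T * T) := [&& t.1.1 \in palette (pairs A), t.1.2 \in A,
  t.2 \in A & ~~ connect (link A t.1.1) t.1.2 t.2].
case: (pickP bad) => [[[g x] y] /and4P[gA xA yA nxy]|nobad]; first by exists g, x, y.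
have all_conn g x y : g \in palette (pairs A) -> x \in A -> y \in A ->
    connect (link A g) x y.
  by move=> gA xA yA; have := nobad (g, x, y); rewrite /bad /= gA xA yA => /negbFE.
exfalso.
have: exists v, v \in A.
  have /card_gt0P[a /palette_pairsP[v [_ [vA _ _ _]]]] :
    0 < #|palette (pairs A)| by lia.
  by exists v.
case=> v vA; pose A' := A :\ v.
(* every color of A is seen from v, so v cannot see only two colors *)
have few g c : ~ (forall x, x \in A' -> (col v x == g) || (col v x == c)).
  move=> gc; have /subsetPn[h hA hgc] : ~~ (palette (pairs A) \subset [set g; c]).
    apply/negP => /subset_leq_card; have := cards2 g c.
    by case: (g != c) => -> /=; lia.
  have [x xA xv] : exists2 x, x \in A & v != x.
    case/palette_pairsP: hA => x [y [xA yA xy _]].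
    have [vx|] := eqVneq v x; last by exists x.
    by exists y; rewrite ?vx.
  have [z /and4P[_ zA vz /eqP vzh]] := connect_link (all_conn _ _ _ hA vA xA) xv.
  have := gc z; rewrite !inE eq_sym vz zA vzh => /(_ isT).
  by move: hgc; rewrite !inE => /negPf ->.
have [col3'|col2] := ltnP 2 #|palette (pairs A')|.
  have ltA'n : #|A'| < n by move: ltAn; rewrite (cardsD1 v A) vA.
  have [g [x0 [y0 [gA' x0A y0A nxy]]]] := IHn _ ltA'n col3'.
  have A'A x : x \in A' -> x \in A by rewrite inE => /andP[].
  have A'v x : x \in A' -> v != x by rewrite !inE eq_sym => /andP[].
  have gA : g \in palette (pairs A).
    case/palette_pairsP: gA' => x [y [xA yA xy xyg]].
    by apply/palette_pairsP; exists x, y; rewrite !A'A.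
  pose conn := connect (link A' g).
  have connC x y : conn x y = conn y x by apply: link_sym.
  have reach z : z \in A' -> exists2 x, conn z x & col v x = g.
    move=> zA; have [/exists_inP[x zx /eqP vx]|/exists_inPn none] :=
      boolP [exists x in conn z, col v x == g]; first by exists x.
    have cl : closed (link A g) (conn z).
      apply: (intro_closed (@link_sym A g)) => x y /and4P[xA yA xy /eqP xyg] zx.
      apply: (connect_trans zx); apply: connect1; apply/and4P.
      have xA' := connect_in zx zA.
      split=> //; last by rewrite xyg.
      rewrite !inE yA andbT; apply: contraNneq (none x zx) => yv.
      by apply/eqP; rewrite colC -yv.
    have := closed_connect cl (all_conn g z v gA (A'A z zA) vA).
    rewrite [LHS]connect0 => /esym zv.
    by have := connect_in zv zA; rewrite !inE eqxx.
  (* a component containing a neighbor of v in a color c other than g is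
     joined in c to every other component *)
  have spread x y : x \in A' -> y \in A' -> col v y != g -> ~~ conn x y ->
      col x y = col v y.
    move=> xA yA vyg nconn; have [x' xx' vx'] := reach x xA.
    rewrite (component_module xA yA xx' nconn).
    have nconn' : ~~ conn x' y by apply: contra nconn; apply: connect_trans.
    have x'A := connect_in xx' xA.
    symmetry; apply: (gallai_eq _ _ _ vx') => //.
    - exact: A'v.
    - exact: unlinked_neq nconn'.
    - exact: A'v.
    - exact: unlinked_col nconn'.
  have uniq y y' : y \in A' -> y' \in A' -> col v y != g -> col v y' != g ->
      col v y = col v y'.
    move=> yA y'A vy vy'; have [yy'|nyy'] := boolP (conn y y'); last first.
      have nyy'C : ~~ conn y' y by rewrite connC.
      by rewrite -(spread y' y) // colC (spread y y').
    have [w wA nyw] : exists2 w, w \in A' & ~~ conn y w.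
      have [yx0|] := boolP (conn y x0); last by exists x0.
      exists y0 => //; apply: contra nxy; apply: connect_trans.
      by rewrite link_sym.
    have ny'w : ~~ conn y' w by apply: contra nyw; apply: connect_trans.
    have := component_module yA wA yy' nyw.
    rewrite ![col _ w]colC !(spread w) // connC //.
  have [/exists_inP[y yA vy]|/exists_inPn none] :=
    boolP [exists y in A', col v y != g].
    apply: (few g (col v y)) => x xA; rewrite -implyNb.
    by apply/implyP => vx; rewrite (uniq x y).
  by apply: (few g g) => x /none; rewrite orbb negbK.
(* some color lives only on edges at v, so it joins v to everything *)
have /subsetPn[g gA gA'] : ~~ (palette (pairs A) \subset palette (pairs A')).
  by apply/negP => /subset_leq_card; lia.
apply: (few g g) => x; rewrite !inE orbb => /andP[xv xA].
have [y /and4P[_ yA xy xyg]] := connect_link (all_conn _ _ _ gA xA vA) xv.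
have [yv|yv] := eqVneq y v; first by rewrite colC -yv.
case/palette_pairsP: gA'; exists x, y.
by rewrite !inE xv yv xA yA; split=> //; apply/eqP.
Qed.

(** The parts of the second kind are the fibers of [f].  The bound 4 on their
    number loses no Gallai partition: when three parts are joined pairwise
    monochromatically in two colors, some part is joined to the two others in a
    single color, which is a decomposition of the first kind. *)
Definition decomposable A :=
  (exists X c, [/\ X != set0, X \proper A &
     forall x y, x \in X -> y \in A :\: X -> col x y = c]) \/
  (exists (f : T -> T) (C : {set K}), [/\ 3 < #|f @: A|, #|C| <= 2 &
     forall x y, x \in A -> y \in A -> f x != f y -> col x y \in C]).

(** Lifts a decomposition along the contraction of modules. *)
Lemma decomposable_pull A (f : T -> T) :
  {in A &, forall x y, f x != f y -> col x y = col (f x) (f y)} ->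
  decomposable (f @: A) -> decomposable A.
Proof.
move=> fcol [[X [c [X0 /properP[XR [r rR rX]] Xc]]] | [h [C [h4 C2 hC]]]].
  left; exists (A :&: f @^-1: X), c; split.
  - have /set0Pn[s sX] := X0; have /imsetP[x xA sx] := subsetP XR s sX.
    by apply/set0Pn; exists x; rewrite !inE xA -sx.
  - apply/properP; split; first exact: subsetIl.
    have /imsetP[x xA rx] := rR; exists x => //.
    by rewrite !inE xA -rx.
  - move=> x y; rewrite !inE => /andP[xA fxX] /andP[+ yA]; rewrite yA /= => fyX.
    have fxy : f x != f y by apply: contraNneq fyX => <-.
    by rewrite fcol //; apply: Xc; rewrite // inE fyX imset_f.
right; exists (h \o f), C; split=> //; first by rewrite imset_comp.
move=> x y xA yA /= hxy; have fxy : f x != f y by apply: contraNneq hxy => ->.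
by rewrite fcol //; apply: hC; rewrite ?imset_f.
Qed.

(** With at most two colors the partition into singletons works for four or more
    vertices, and a monochromatic cherry splits a triangle.  With more colors,
    contract the components of a disconnected color and use induction. *)
Lemma gallai_decomposable A : 1 < #|A| -> decomposable A.
Proof.
have [n] := ubnP #|A|; elim: n A => // n IHn A ltAn A2.
have [col3|col2] := ltnP 2 #|palette (pairs A)|; last first.
  have [A4|A3] := ltnP 3 #|A|.
    right; exists id, (palette (pairs A)); rewrite imset_id; split=> // x y xA yA xy.
    by apply/palette_pairsP; exists x, y.
  left; have single z c : z \in A ->
      (forall y, y \in A -> y != z -> col z y = c) ->
      exists X c, [/\ X != set0, X \proper A &
        forall x y, x \in X -> y \in A :\: X -> col x y = c].
    move=> zA zc; exists [set z], c; split.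
    - by apply/set0Pn; exists z; rewrite inE.
    - by rewrite properEcard sub1set zA cards1.
    - by move=> x y /set1P ->; rewrite !inE => /andP[yz yA]; apply: zc.
  have [/cards2P[x [y [xy defA]]]|nA2] := boolP (#|A| == 2).
    apply: (single x (col x y)); rewrite defA ?inE ?eqxx //.
    by move=> z; rewrite !inE => /orP[] /eqP -> //; rewrite eqxx.
  have [|x [y [z [xy yz xz defA]]]] := @cards3_triple _ A; first by lia.
  case/or3P: (col_gallai xy yz xz) => /eqP ee.
  - apply: (single y (col x y)); rewrite defA ?inE ?eqxx ?orbT //.
    move=> w; rewrite !inE => /orP[/orP[]|] /eqP -> //; rewrite ?eqxx //.
  - apply: (single x (col x y)); rewrite defA ?inE ?eqxx ?orbT //.
    move=> w; rewrite !inE => /orP[/orP[]|] /eqP -> //; rewrite ?eqxx //.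
  - apply: (single z (col x z)); rewrite defA ?inE ?eqxx ?orbT //.
    move=> w; rewrite !inE => /orP[/orP[]|] /eqP -> //; rewrite ?eqxx // colC //.
have [g [x0 [y0 [gA x0A y0A nxy]]]] := disconnected_color col3.
pose f := root (link A g); have gsym := @link_sym A g.
have fA x : x \in A -> f x \in A by apply: connect_in; apply: connect_root.
apply: (@decomposable_pull A f).
  move=> x y xA yA; rewrite /f root_connect // => nconn.
  have nconn' : ~~ connect (link A g) y (f x).
    apply: contra nconn => yfx; rewrite gsym; apply: connect_trans yfx _.
    by rewrite gsym; apply: connect_root.
  rewrite (component_module xA yA (connect_root (link A g) x) nconn) colC.
  by rewrite (component_module yA (fA x xA) (connect_root (link A g) y) nconn') colC.
apply: IHn.
  suff : #|f @: A| < #|A| by lia.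
  rewrite ltn_neqAle leq_imset_card andbT; apply/negP => /imset_injP finj.
  case/palette_pairsP: gA => x [y [xA yA xy xyg]].
  move: (xy); rewrite (finj x y) ?eqxx //; apply/eqP.
  by rewrite root_connect //; apply: connect1; rewrite /link /= xA yA xy xyg eqxx.
rewrite (cardsD1 (f x0)) imset_f //.
rewrite add1n ltnS card_gt0; apply/set0Pn; exists (f y0).
by rewrite !inE imset_f // andbT /f eq_sym root_connect.
Qed.

(** * The load inequality *)

(** The bound is attained by a single edge and by two-colored complete graphs on
    four vertices without a star color. *)
Lemma load_pairs A : 1 < #|A| -> 2 * load (pairs A) + 4 <= 3 * #|A|.
Proof.
have [n] := ubnP #|A|; elim: n A => // n IHn A ltAn A2.
(* singletons miss the bound of the induction hypothesis by one *)
have le3 B : B != set0 -> #|B| < #|A| -> 2 * load (pairs B) + 3 <= 3 * #|B|.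
  rewrite -card_gt0 => B0 BA; have [B2|B1] := ltnP 1 #|B|.
    by have := IHn B; lia.
  have /eqP/cards1P[x ->] : #|B| = 1 by lia.
  rewrite cards1 (_ : pairs [set x] = set0) ?load0 //.
  apply/setP => -[u w]; rewrite !inE /=; apply/negP => /and3P[/eqP-> /eqP->].
  by rewrite eqxx.
have [[X [c [X0 XA Xc]]]|[f [C [f4 C2 fC]]]] := gallai_decomposable A2.
  pose Y := A :\: X.
  pose cross := setX X Y :|: setX Y X.
  have sXA := proper_sub XA.
  have cardA : #|X| + #|Y| = #|A| by rewrite -(cardsID X A) (setIidPr sXA).
  have X1 : 0 < #|X| by rewrite card_gt0.
  have Y1 : 0 < #|Y| by have := proper_card XA; lia.
  have defA : pairs A = pairs X :|: pairs Y :|: cross.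
    apply/setP => -[u w]; rewrite !inE /=.
    have /implyP := subsetP sXA u; have /implyP := subsetP sXA w.
    have [->|uw] := eqVneq u w.
      by case: (w \in X); case: (w \in A).
    by case: (u \in X); case: (w \in X); case: (u \in A); case: (w \in A).
  have cross1 : #|palette cross| <= 1.
    rewrite -(cards1 c) subset_leq_card //; apply/subsetP => a /imsetP[[u w]].
    rewrite !(in_setU, in_setX) /= => uw ->; rewrite inE; apply/eqP.
    by case/orP: uw => /andP[uX wX]; [|rewrite colC]; apply: Xc.
  have crossX : #|X| = 1 -> load cross <= 1.
    move/eqP/cards1P => [v Xv]; rewrite (@load_star v) //.
    apply/setP => -[u w]; rewrite !inE Xv !inE /=.
    by case: (u == v); case: (w == v); rewrite ?andbF.
  have crossY : #|Y| = 1 -> load cross <= 1.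
    move/eqP/cards1P => [v Yv]; rewrite (@load_star v) //.
    apply/setP => -[u w]; rewrite in_set /cross Yv !in_setU !in_setX !in_set1 /= in_set0.
    by case: (u == v); case: (w == v); rewrite ?andbF.
  (* two parts of size at least 2 leave room for a crossing color of charge 2,
     and a part of size 1 covers the crossing color *)
  have := loadU (pairs X :|: pairs Y) cross.
  have := loadU (pairs X) (pairs Y).
  have := load_le cross.
  have := le3 X X0; have := le3 Y; rewrite -card_gt0 => /(_ Y1).
  have := IHn X; have := IHn Y.
  rewrite defA; lia.
pose part i := [set x in A | f x == i].
pose cross := [set u in pairs A | f u.1 != f u.2].
have defA : pairs A = (\bigcup_(i in f @: A) pairs (part i)) :|: cross.
  apply/setP => -[u w]; rewrite in_setU; apply/idP/orP.
    move=> uw; have [fuw|fuw] := eqVneq (f u) (f w); last first.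
      by right; rewrite inE uw.
    left; move: uw; rewrite inE => /and3P[/= uA wA uw].
    by apply/bigcupP; exists (f u); rewrite ?imset_f // !inE /= uA wA fuw eqxx.
  case; last by rewrite inE => /andP[].
  by case/bigcupP=> i _; rewrite !inE /= => /and3P[/andP[-> _] /andP[-> _] ->].
have crossC : #|palette cross| <= 2.
  apply: leq_trans C2; apply: subset_leq_card; apply/subsetP => a /imsetP[[u w]].
  by rewrite !inE /= => /andP[/and3P[uA wA _] fuw] ->; apply: fC.
have cardA : \sum_(i in f @: A) #|part i| = #|A|.
  rewrite -[RHS]sum1_card [RHS](partition_big_imset f) /=; apply: eq_bigr => i _.
  by rewrite -sum1_card; apply: eq_bigl => x; rewrite inE.
have sum3 : \sum_(i in f @: A) (2 * load (pairs (part i)) + 3)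
    <= \sum_(i in f @: A) 3 * #|part i|.
  apply: leq_sum => i iA; apply: le3.
    case/imsetP: iA => x xA ->; apply/set0Pn; exists x.
    by rewrite inE xA eqxx.
  apply: proper_card; apply/properP; split.
    by apply/subsetP => x; rewrite inE => /andP[].
  have : 0 < #|f @: A :\ i| by have := cardsD1 i (f @: A); lia.
  case/card_gt0P => j; rewrite !inE => /andP[ji /imsetP[x xA jx]].
  by exists x => //; rewrite inE xA -jx.
move: sum3; rewrite big_split /= -!big_distrr /= cardA sum_nat_const.
have : load (\bigcup_(i in f @: A) pairs (part i)) <=
  \sum_(i in f @: A) load (pairs (part i)) by apply: load_bigcup.
have := loadU (\bigcup_(i in f @: A) pairs (part i)) cross.
have := load_le cross.
rewrite -defA; lia.
Qed.

(** If no color could be destroyed, the load would be twice the number of colors,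
    at least 2(n - 3), contradicting [load_pairs] for n > 8. *)
Lemma losing_vertex A : 8 < #|A| -> #|A| <= #|palette (pairs A)| + 3 ->
  exists2 v, v \in A & #|palette (pairs (A :\ v))| < #|palette (pairs A)|.
Proof.
move=> A9 few; have A2 : 1 < #|A| by lia.
have /subsetPn[a aA] : ~~ (palette (pairs A) \subset robust (pairs A)).
  apply/negP => /subset_leq_card; have := load_pairs A2; rewrite /load; lia.
rewrite inE aA => /forallPn[v av].
have sub B : pairs (B :\ v) \subset avoid v (pairs B).
  apply/subsetP => -[x y]; rewrite !inE /=.
  by case/and3P=> /andP[-> ->] /andP[-> ->] ->.
have lose : a \notin palette (pairs (A :\ v)).
  by apply: contra av; apply/subsetP/paletteS/sub.
exists v.
  apply: contraR lose => vA; suff -> : A :\ v = A by [].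
  by apply/setDidPl; rewrite disjoint_sym disjoints1.
apply: proper_card; apply/properP; split; last by exists a.
apply/paletteS/subsetP => u; rewrite !inE.
by case/and3P=> /andP[_ ->] /andP[_ ->].
Qed.

(** While more than [p] vertices remain there are at least 9, so a tight set has
    a vertex whose deletion costs a color; a slack one may lose any vertex. *)
Lemma descend p A : 8 <= p <= #|A| -> #|palette (pairs A)| + 3 <= #|A| ->
  exists2 B : {set T}, #|B| = p & #|palette (pairs B)| + 3 <= p.
Proof.
have [n] := ubnP #|A|; elim: n A => // n IHn A ltAn /andP[p8 pA] few.
have [->|neq] := eqVneq p #|A|; first by exists A.
have [v vA vfew] : exists2 v, v \in A & #|palette (pairs (A :\ v))| + 4 <= #|A|.
  have [tight|slack] := leqP #|A| (#|palette (pairs A)| + 3).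
    have [|v vA lose] := losing_vertex _ tight; first by lia.
    by exists v; rewrite // (leq_trans _ few); lia.
  have /card_gt0P[v vA] : 0 < #|A| by lia.
  exists v => //; have : palette (pairs (A :\ v)) \subset palette (pairs A).
    apply/paletteS/subsetP => u; rewrite !inE.
    by case/and3P=> /andP[_ ->] /andP[_ ->].
  by move/subset_leq_card; lia.
have := cardsD1 v A; rewrite vA => cA.
by apply: (IHn (A :\ v)); lia.
Qed.

End GallaiColoring.

(** * Colorings of edges as symmetric functions of two vertices *)

Section Edges.
Variables (n k : nat) (c : coloring n k).

(** The diagonal, which is not made of edges, gets the extra value [None]. *)
Definition edge_col (x y : 'I_n) : option 'I_k := omap c (insub [set x; y]).

Lemma edge_colC x y : edge_col x y = edge_col y x.
Proof. by rewrite /edge_col setUC. Qed.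

Lemma edge_colE (e : edge n) x y : val e = [set x; y] -> edge_col x y = Some (c e).
Proof. by rewrite /edge_col => <-; rewrite valK. Qed.

Lemma edgeP x y : x != y -> exists e : edge n, val e = [set x; y].
Proof.
move=> xy; have xy2 : #|[set x; y]| == 2 by rewrite cards2 xy.
by exists (exist (fun e : {set 'I_n} => #|e| == 2) _ xy2).
Qed.

Lemma edge_palette (A : {set 'I_n}) :
  palette edge_col (pairs A) = Some @: colors_on c A.
Proof.
apply/setP => a; apply/palette_pairsP/imsetP.
  case=> x [y [xA yA xy <-]]; have [e eE] := edgeP xy.
  exists (c e); last exact: edge_colE.
  by apply/imsetP; exists e; rewrite // inE eE subUset !sub1set xA.
case=> _ /imsetP[e eA ->] ->; have /cards2P[x [y [xy eE]]] := valP e.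
exists x, y; move: eA; rewrite inE eE subUset !sub1set => /andP[xA yA].
by split=> //; apply: edge_colE.
Qed.

Lemma edge_gallai : gallai c -> forall x y z, x != y -> y != z -> x != z ->
  [|| edge_col x y == edge_col y z, edge_col x y == edge_col x z
    | edge_col y z == edge_col x z].
Proof.
move=> gc x y z xy yz xz.
have T3 : #|[set x; y; z]| = 3.
  by rewrite setUC cardsU1 cards2 !inE xy ![z == _]eq_sym negb_or xz yz.
have := gc _ T3; rewrite -(card_imset _ (@Some_inj _)) -edge_palette.
apply: contraLR; rewrite !negb_or -ltnNge => /and3P[d1 d2 d3].
pose S := [set edge_col x y; edge_col y z; edge_col x z].
have <- : #|S| = 3.
  rewrite /S setUC cardsU1 cards2 !inE d1.
  by rewrite negb_or ![edge_col x z == _]eq_sym d2 d3.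
apply: subset_leq_card; apply/subsetP => a; rewrite !inE.
by case/orP=> [/orP[]|] /eqP ->; apply/palette_pairsP; do 2 eexists;
  split; try reflexivity; rewrite ?inE ?eqxx ?orbT.
Qed.

End Edges.

(** * A coloring with few repeated colors *)

Section MaxColoring.
Variables n k : nat.

Definition max_coloring : coloring n k.+1 :=
  [ffun e : edge n => inord (\max_(i in val e) i - 2)].

(** The larger end of an edge inside [A] is never the minimum of [A], and every
    other vertex of [A] is the larger end of its edge to the minimum. *)
Lemma colors_on_max (A : {set 'I_n}) (m : 'I_n) : m \in A ->
  {in A, forall x : 'I_n, m <= x} ->
  colors_on max_coloring A = [set inord (x - 2) | x : 'I_n in A :\ m].
Proof.
move=> mA mmin.
have maxE (x y : 'I_n) : x != y -> \max_(i in [set x; y]) i = maxn x y.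
  by move=> xy; rewrite big_setU1 ?inE //= big_set1.
apply/setP => a; apply/imsetP/imsetP => -[].
  move=> e; rewrite inE => + ->; rewrite ffunE.
  have /cards2P[x [y [xy ->]]] := valP e; rewrite maxE //.
  rewrite subUset !sub1set => /andP[xA yA].
  have /eqP nxy : val x != val y by [].
  have := mmin x xA; have := mmin y yA => my mx.
  have [le|le] := leqP x y; [exists y | exists x] => //;
    rewrite !inE ?xA ?yA andbT; apply/eqP => /(congr1 val) /= eq_m;
  move: nxy my mx le eq_m => /=; lia.
move=> x; rewrite !inE => /andP[xm xA] ->; have [e eE] := edgeP xm.
exists e; first by rewrite inE eE subUset !sub1set xA mA.
by rewrite ffunE eE maxE // (maxn_idPl (mmin x xA)).
Qed.

Lemma set_min (A : {set 'I_n}) : 0 < #|A| ->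
  exists2 m, m \in A & {in A, forall x : 'I_n, m <= x}.
Proof.
by case/card_gt0P=> x xA; case: (arg_minnP (fun i : 'I_n => nat_of_ord i) xA) => m; exists m.
Qed.

Lemma max_coloring_gallai : gallai max_coloring.
Proof.
move=> A A3; have [|m mA mmin] := @set_min A; first by rewrite A3.
have Am : #|A :\ m| <= 2 by have := cardsD1 m A; rewrite mA A3; lia.
by rewrite (colors_on_max mA mmin); apply: leq_trans (leq_imset_card _ _) Am.
Qed.

(** The minimum of [A] contributes no color and the vertex 1 may repeat the color
    of 2; on all vertices from 2 on the color determines the vertex. *)
Lemma max_coloring_many (A : {set 'I_n}) : n <= k.+3 ->
  #|A| <= #|colors_on max_coloring A| + 2.
Proof.
move=> nk; have [->//|A0] := posnP #|A|; have [m mA mmin] := set_min A0.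
pose B := [set x in A :\ m | val x != 1].
have BA : #|A| <= #|B| + 2.
  pose S := [set x : 'I_n | val x == 1].
  have S1 : #|S| <= 1.
    apply/card_le1_eqP => x y; rewrite !inE => /eqP x1 /eqP y1.
    by apply: val_inj; rewrite x1 y1.
  have sub : A :\ m \subset B :|: S.
    by apply/subsetP => x xA; apply/setUP; have [x1|x1] := eqVneq (val x) 1;
      [right | left]; rewrite inE ?xA x1.
  have BS : #|A :\ m| <= #|B| + #|S|.
    exact: leq_trans (subset_leq_card sub) (leq_of_leqif (leq_card_setU B S)).
  have Am : #|A| = #|A :\ m| + 1 by rewrite (cardsD1 m A) mA addnC.
  lia.
apply: leq_trans BA _; rewrite leq_add2r (colors_on_max mA mmin).
rewrite -(card_in_imset (f := fun x : 'I_n => inord (x - 2) : 'I_k.+1) (D := B)).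
  by apply/subset_leq_card/imsetS/subsetP => x; rewrite inE => /andP[].
have B2 x : x \in B -> 2 <= x.
  rewrite !inE => /andP[/andP[xm xA] x1]; have := mmin x xA.
  have : val x != val m by [].
  by move: x1 => /=; lia.
move=> x y /B2 x2 /B2 y2 /(congr1 val) /=.
have xn := ltn_ord x; have yn := ltn_ord y.
rewrite !inordK; try lia.
by move=> xy; apply: val_inj => /=; lia.
Qed.

End MaxColoring.

Theorem theorem1p10 (p k : nat) (hp : 8 <= p) (hk : p - 3 <= k) :
  gallai_number k (p - 3) p (k + 3).
Proof.
split; first by rewrite addnS.
- move=> c /edge_gallai gc.
  have few : #|palette (edge_col c) (pairs setT)| <= k.
    rewrite edge_palette card_imset; last exact: Some_inj.
    by rewrite -[leqRHS]card_ord max_card.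
  have [||B Bp] := descend (@edge_colC _ _ c) gc (p := p) (A := setT).
  + by rewrite cardsT card_ord hp; lia.
  + by rewrite cardsT card_ord leq_add2r.
  rewrite edge_palette card_imset; last exact: Some_inj.
  by move=> Bfew; exists B; split=> //; lia.
- move=> n n0 fn; rewrite leqNgt; apply/negP => nk.
  case: k hk nk fn => [|k'] hk' nk fn; first by lia.
  have [A [Ap]] := fn _ (@max_coloring_gallai n k').
  by have := @max_coloring_many n k' A; lia.
Qed.
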